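(* Let $\Phi:\mathbb R\to\mathbb R$ be a $2\pi$-periodic bounded function whose set of points of discontinuity has (Lebesgue) measure zero. Suppose that $\Phi$ is differentiable at a point $t_0\in\mathbb R$. Then $$\lim_{z\to\zeta_0}\ \mathbb U_{\Phi}(z)\ =\ \Phi'(t_0)$$ along all nontangential paths in $\mathbb D$ to the point $\zeta_0:=e^{it_0}\in\partial\mathbb D$.
   Context: $\mathbb D=\{z\in\mathbb C:|z|<1\}$. For arbitrary functions $g,f$ on a compact interval $[a,b]$, the Riemann--Stieltjes integral $\int_a^b g\,df$ is the limit, as $\delta:=\max_k|t_k-t_{k-1}|\to0$, of the sums $\sum_{k=1}^p g(\tau_k)\,(f(t_k)-f(t_{k-1}))$ over partitions $a=t_0\le t_1\le\dots\le t_p=b$ and points $\tau_k\in[t_{k-1},t_k]$, provided a finite limit exists, uniform with respect to the partitions and the intermediate points (no monotonicity or bounded variation is assumed). The Poisson kernel is $P_r(\Theta)=\dfrac{1-r^2}{1-2r\cos\Theta+r^2}$, $0\le r<1$, $\Theta\in\mathbb R$. For a $2\pi$-periodic bounded function $\Phi:\mathbb R\to\mathbb R$ whose set of discontinuities has measure zero, the Poisson--Stieltjes integral $$\mathbb U_\Phi(z):=\frac1{2\pi}\int_{-\pi}^{\pi}P_r(\vartheta-t)\,d\Phi(t),\qquad z=re^{i\vartheta},\ r<1,$$ is understood as such a Riemann--Stieltjes integral (it exists). A path in $\mathbb D$ terminating at $\zeta\in\partial\mathbb D$ is nontangential if its part in a neighborhood of $\zeta$ lies inside an angle in $\mathbb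 D$ with vertex at $\zeta$; the limit along all nontangential paths is called the angular limit at $\zeta$. *)

(* Defs.v *)
(* MathComp-Analysis, over an arbitrary R : realType. *)
From HB Require Import structures.
From mathcomp Require Import all_boot all_order all_algebra.
From mathcomp Require Import complex.
From mathcomp Require Import all_classical all_reals all_analysis.

Set Implicit Arguments.
Unset Strict Implicit.
Unset Printing Implicit Defensive.

Import Order.TTheory GRing.Theory Num.Theory.
Import numFieldNormedType.Exports.

Local Open Scope classical_set_scope.
Local Open Scope ring_scope.
Local Open Scope complex_scope.

(* [R[i]] seen as a [numFieldType], so that it carries the topology of its
   norm: the library declares that topology on abstract [numFieldType]s only. *)
Definition Cplx (R : realType) : numFieldType := R[i].

Section RiemannStieltjes.
Variable R : realType.

(* The points t_0 <= ... <= t_p and the tags are sequences of which only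
   the terms t_0, ..., t_p and tau_0, ..., tau_(p-1) matter; tau_k is the tag
   of [t_k, t_(k+1)]. *)
Definition tagged_partition (a b : R) (p : nat) (t tau : nat -> R) : Prop :=
  [/\ t 0%N = a, t p = b &
      forall k, (k < p)%N -> t k <= tau k <= t k.+1].

Definition RS_sum (g f : R -> R) (p : nat) (t tau : nat -> R) : R :=
  \sum_(k < p) g (tau k) * (f (t k.+1) - f (t k)).

Definition is_RS_integral (g f : R -> R) (a b I : R) : Prop :=
  forall eps : R, 0 < eps -> exists2 delta : R, 0 < delta &
    forall (p : nat) (t tau : nat -> R), tagged_partition a b p t tau ->
      (forall k, (k < p)%N -> `|t k.+1 - t k| < delta) ->
      `|RS_sum g f p t tau - I| < eps.

(* Set to 0 when the integral does not exist. *)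
Definition RS_integral (g f : R -> R) (a b : R) : R :=
  xget 0 [set I | is_RS_integral g f a b I].

End RiemannStieltjes.

Section PoissonStieltjes.
Variable R : realType.

Definition polar (r theta : R) : Cplx R :=
  (r * cos theta) +i* (r * sin theta).

Definition modulus (z : Cplx R) : R := complex.Re `|z|.

(* The argument in ]-pi, pi]; for z = 0 every angle qualifies and one is chosen. *)
Definition argument (z : Cplx R) : R :=
  xget 0 [set theta | - pi < theta <= pi /\ z = polar (modulus z) theta].

Definition poisson_kernel (r Theta : R) : R :=
  (1 - r ^+ 2) / (1 - 2 * r * cos Theta + r ^+ 2).

Definition poisson_stieltjes (Phi : R -> R) (z : Cplx R) : R :=
  (2 * pi)^-1 *
  RS_integral (fun t => poisson_kernel (modulus z) (argument z - t)) Phi (- pi) pi.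

End PoissonStieltjes.

Section AngularLimit.
Variable R : realType.

Definition unit_disk : set (Cplx R) := [set z | `|z| < 1].

(* A path ending at zeta, which it reaches only in the limit s -> 1-. *)
Definition disk_path_to (zeta : Cplx R) (gamma : R -> Cplx R) : Prop :=
  [/\ {within `[0, 1[, continuous gamma},
      (forall s : R, 0 <= s < 1 -> unit_disk (gamma s)) &
      gamma s @[s --> 1^'-] --> zeta].

(* The angle with vertex zeta and directions in ]alpha, beta[, truncated at
   distance d from its vertex. *)
Definition angle_at (zeta : Cplx R) (alpha beta d : R) : set (Cplx R) :=
  [set z | exists rho phi : R,
     [/\ 0 < rho < d, alpha < phi < beta & z = zeta + polar rho phi]].

(* The whole truncated angle lies in the disk, so neither side of the angle
   can be tangent to the unit circle at zeta. *)
Definition nontangential (zeta : Cplx R) (gamma : R -> Cplx R) : Prop :=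
  exists alpha beta d : R,
    [/\ 0 < d, angle_at zeta alpha beta d `<=` unit_disk &
        \forall w \near zeta,
          (gamma @` `[0, 1[) w -> angle_at zeta alpha beta d w].

Definition angular_limit (U : Cplx R -> R) (zeta : Cplx R) (l : R) : Prop :=
  forall gamma : R -> Cplx R,
    disk_path_to zeta gamma -> nontangential zeta gamma ->
    U (gamma s) @[s --> 1^'-] --> l.

End AngularLimit.

(* Main.v *)
(** Summation by parts turns the integral of [h = P_r (theta - .)] against
    [dPhi] into minus the integral of [Phi] against [dh]; it exists by dominated
    convergence, since [Phi] is bounded and almost everywhere continuous, and the
    boundary terms cancel by periodicity.  Let [c] be the chord length
    [2 |sin ((t - t0) / 2)|] and [L] the derivative of [Phi] at [t0]; then [Phi t]
    is [Phi t0 + L sin (t - t0)] up to an error [eps c + K c^3] valid for all [t].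
    In a nontangential approach [|theta - t0|] is at most of order [1 - r], and
    then, pointwise, [|h'| c] is at most a constant times [h], while [h c^2] is at
    most a constant times [1 - r].  Since [h] has total mass [2 pi], the error
    contributes [O(eps) + O(1 - r)], and the main term integrates to
    [2 pi L + O(1 - r)]. *)
Require Import Defs.
From HB Require Import structures.
From mathcomp Require Import all_boot all_order all_algebra.
From mathcomp Require Import complex.
From mathcomp Require Import all_classical all_reals all_analysis.
From mathcomp Require Import measurable_realfun ring lra.

Set Implicit Arguments.
Unset Strict Implicit.
Unset Printing Implicit Defensive.

Import Order.TTheory GRing.Theory Num.Theory.
Import numFieldNormedType.Exports.

Local Open Scope classical_set_scope.
Local Open Scope ring_scope.

(** * Riemann-Stieltjes integrals: existence, integration by parts, uniqueness *)

Section RiemannStieltjesIntegral.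
Context {R : realType}.
Local Notation mu := (@lebesgue_measure R).

Lemma bounded_measurable_integrable (f : R -> R) (A : set R) (a b K : R) :
  measurable A -> A `<=` `[a, b] -> measurable_fun setT f ->
  (forall x, A x -> `|f x| <= K) -> mu.-integrable A (EFin \o f).
Proof.
move=> mA Aab mf fK; apply: measurable_bounded_integrable => //.
- apply: (@le_lt_trans _ _ (mu `[a, b])); first by apply: le_measure; rewrite ?inE.
  by rewrite lebesgue_measure_itv/=; case: ifP => // _; rewrite -EFinD ltry.
- exact: measurable_funS mf.
- exists K; split; first exact: num_real.
  by move=> M KM x Ax /=; apply: le_trans (fK x Ax) _; exact: ltW.
Qed.

Lemma continuous_bounded_segment (g : R -> R) (a b : R) :
  continuous g -> exists K : R, forall x : R, x \in `[a, b] -> `|g x| <= K.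
Proof.
move=> cg.
have [M [Mr MK]] : bounded_set (g @` `[a, b]).
  apply: compact_bounded; apply: continuous_compact; last exact: segment_compact.
  exact: continuous_subspaceT.
by exists (M + 1) => x xab; apply: (MK (M + 1)); [rewrite ltrDl | exists x].
Qed.

Lemma continuous_integrable_segment (g : R -> R) (a b : R) :
  continuous g -> mu.-integrable `[a, b] (EFin \o g).
Proof.
move=> cg; apply: continuous_compact_integrable; first exact: segment_compact.
exact: continuous_subspaceT.
Qed.

Lemma Rintegral_is_derive (G g : R -> R) (a b : R) : a <= b ->
  (forall x : R, is_derive x (1 : R) G (g x)) -> continuous g ->
  \int[mu]_(x in `[a, b]) g x = G b - G a.
Proof.
rewrite le_eqVlt => /predU1P[->|ab] dG cg.
  by rewrite set_itv1 Rintegral_set1 subrr.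
have cG : continuous G.
  by move=> x; apply: differentiable_continuous; apply/derivable1_diffP; case: (dG x).
rewrite /Rintegral (@continuous_FTC2 _ g G)//.
- exact: continuous_subspaceT.
- split.
  + by move=> x _; case: (dG x).
  + exact: cvg_at_right_filter (cG a).
  + exact: cvg_at_left_filter (cG b).
- by move=> x _; rewrite derive1E; case: (dG x).
Qed.

Lemma Rintegral_bounded_cvg (s_ : nat -> R -> R) (F : R -> R) (a b K : R) :
  (forall n, measurable_fun setT (s_ n)) -> measurable_fun setT F ->
  (forall n x, x \in `[a, b] -> `|s_ n x| <= K) ->
  {ae mu, forall x, x \in `[a, b] -> s_ n x @[n --> \oo] --> F x} ->
  \int[mu]_(x in `[a, b]) s_ n x @[n --> \oo] --> \int[mu]_(x in `[a, b]) F x.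
Proof.
move=> ms mF sK sF.
have iK : mu.-integrable `[a, b] (fun=> K%:E).
  exact: (@bounded_measurable_integrable (cst K) _ a b `|K|).
have iF n : mu.-integrable `[a, b] (EFin \o s_ n).
  by apply: (bounded_measurable_integrable (a := a) (b := b) (K := K)) => // x xab; exact: sK.
have [|||||iF' _ cvF] := @dominated_convergence _ _ _ mu `[a, b] _
    (fun n x => (s_ n x)%:E) (fun x => (F x)%:E) (fun=> K%:E) _ _ _ iK.
- by [].
- by move=> n; apply/measurable_EFinP; exact: measurable_funS (ms n).
- by apply/measurable_EFinP; exact: measurable_funS mF.
- apply: (negligibleS _ sF) => x /=; apply: contra_not => {}sF xab.
  by apply: cvg_EFin; [exact: nearW|exact: sF].
- by apply: aeW => x n xab; rewrite lee_fin sK.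
apply: fine_cvg; rewrite fineK//; exact: integrable_fin_num.
Qed.

(** A Riemann-Stieltjes sum against a smooth integrator is a Lebesgue integral: on the cell from
    [t k] to [t k.+1] the step function is [f (tau k)], and integrating [g] over the cell gives the
    increment of [G]. Half-open cells are disjoint, and degenerate ones are empty. *)
Lemma RS_sum_step (f G g : R -> R) (M : R) (p : nat) (t tau : nat -> R) :
  (forall x : R, is_derive x (1 : R) G (g x)) -> continuous g ->
  (forall x, `|f x| <= M) ->
  (forall k, (k < p)%N -> t k <= tau k <= t k.+1) ->
  t 0%N <= t p /\ exists s : R -> R, [/\ measurable_fun setT s,
    (forall x, `|s x| <= M),
    (forall x, t 0%N <= x < t p ->
       exists2 k, (k < p)%N & t k <= x < t k.+1 /\ s x = f (tau k)) &
    \int[mu]_(x in `[t 0%N, t p[) (s x * g x) = RS_sum f G p t tau].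
Proof.
move=> dG cg fM; have M0 : 0 <= M := le_trans (normr_ge0 _) (fM 0).
elim: p => [|p IH] ht.
  split => //; exists (cst 0); split => //.
  - by move=> x; rewrite normr0.
  - by move=> x /andP[t0x xt0]; have := le_lt_trans t0x xt0; rewrite ltxx.
  - by rewrite set_itvco0 Rintegral_set0 /RS_sum big_ord0.
have [|t0p [s [ms sM sf si]]] := IH; first by move=> k kp; apply: ht; exact: ltnW.
have tp1 : t p <= t p.+1 by have /andP[] := ht p (ltnSn p); exact: le_trans.
split; first exact: le_trans tp1.
(* The last value is extended to all [x >= t p], so that [s'] is measurable and bounded on the whole
   line. *)
pose s' x := if x < t p then s x else f (tau p).
have ms' : measurable_fun setT s'.
  by apply: measurable_fun_ifT => //; exact: measurable_fun_ltr.
have s'M x : `|s' x| <= M by rewrite /s'; case: ifP.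
exists s'; split => //.
- move=> x /andP[t0x xtp]; rewrite /s'; case: ltP => xp.
    have [|k kp [h1 h2]] := sf x; first by rewrite t0x.
    by exists k => //; rewrite ltnS ltnW.
  by exists p => //; rewrite xp xtp.
have mg : measurable_fun setT g by exact: continuous_measurable_fun.
have [Kg gK] := continuous_bounded_segment (t 0%N) (t p.+1) cg.
have i (s0 : R -> R) : measurable_fun setT s0 -> (forall x, `|s0 x| <= M) ->
    mu.-integrable `[t 0%N, t p.+1] (EFin \o (fun x => s0 x * g x)).
  move=> ms0 s0M.
  apply: (bounded_measurable_integrable (a := t 0%N) (b := t p.+1) (K := M * Kg)) => //.
    exact: measurable_funM.
  by move=> x xab; rewrite normrM ler_pM// gK.
have is' : mu.-integrable `[t 0%N, t p.+1[ (EFin \o (fun x => s' x * g x)).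
  by apply: integrableS (i _ ms' s'M) => //; exact: subset_itv_co_cc.
have U : `[t 0%N, t p.+1[%classic = `[t 0%N, t p[ `|` `[t p, t p.+1[.
  by apply: itv_bndbnd_setU; rewrite bnd_simp.
rewrite /RS_sum big_ord_recr/= -/(RS_sum f G p t tau) -si U Rintegral_setU//; last 2 first.
- by rewrite -U.
- apply/disj_setPS => x [] /=; rewrite !in_itv/= => /andP[_ xp] /andP[px _].
  by have := lt_le_trans xp px; rewrite ltxx.
congr (_ + _).
  by apply: eq_Rintegral => x; rewrite inE/= in_itv/= => /andP[_ xp]; rewrite /s' xp.
transitivity (\int[mu]_(x in `[t p, t p.+1[) (f (tau p) * g x)).
  apply: eq_Rintegral => x; rewrite inE/= in_itv/= => /andP[px _].
  by rewrite /s' ltNge px.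
have ig : mu.-integrable `[t p, t p.+1[ (EFin \o g).
  apply: integrableS (continuous_integrable_segment (t p) (t p.+1) cg) => //.
  exact: subset_itv_co_cc.
by rewrite RintegralZl// Rintegral_itv_bndo_bndc// (Rintegral_is_derive tp1 dG cg).
Qed.

(** If convergence failed for some [eps], each mesh bound [1 / (n + 1)] would yield a bad sum, hence
    a step function whose value at [x] is a value of [f] within [1 / (n + 1)] of [x]. These converge
    to [f] wherever [f] is continuous, and dominated convergence contradicts the gap [eps]. [F] is a
    measurable stand-in for [f], which is not itself assumed measurable. *)
Lemma is_RS_integral_Rintegral (f F G g : R -> R) (a b M : R) :
  (forall x : R, is_derive x (1 : R) G (g x)) -> continuous g ->
  (forall x, `|f x| <= M) -> measurable_fun setT F ->
  {ae mu, forall x, {for x, continuous f} /\ F x = f x} ->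
  is_RS_integral f G a b (\int[mu]_(x in `[a, b]) (F x * g x)).
Proof.
move=> dG cg fM mF aeF eps eps0; apply: contrapT => /forall2NP H.
have {}H (n : nat) : exists s : R -> R, [/\ measurable_fun setT s,
    (forall x, `|s x| <= M),
    (forall x, a <= x < b -> exists2 y, `|y - x| < n.+1%:R^-1 & s x = f y) &
    `|\int[mu]_(x in `[a, b[) (s x * g x) -
      \int[mu]_(x in `[a, b]) (F x * g x)| >= eps].
  have [|] := H n.+1%:R^-1; first by rewrite invr_gt0 ltr0n.
  move=> /existsNP[p /existsNP[t /existsNP[tau]]].
  move=> /not_implyP[[t0 tp ht]] /not_implyP[mesh /negP].
  rewrite -leNgt => bad.
  have [_ [s [ms sM sf si]]] := RS_sum_step dG cg fM ht.
  exists s; split => //.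
    move=> x; rewrite -t0 -tp => /sf[k kp [/andP[h1 h2] ->]].
    exists (tau k) => //; have /andP[h3 h4] := ht _ kp.
    apply: le_lt_trans (mesh _ kp); rewrite [leRHS]ger0_norm; last first.
      by rewrite subr_ge0 (le_trans h3).
    by rewrite ler_norml; apply/andP; split; lra.
  by rewrite -t0 -tp si t0 tp.
have [s_ sP] := choice H.
have [Kg gK] := continuous_bounded_segment a b cg.
have mg : measurable_fun setT g by exact: continuous_measurable_fun.
have ms n : measurable_fun setT (fun x => s_ n x * g x).
  by apply: measurable_funM => //; have [] := sP n.
have sK n x : x \in `[a, b] -> `|s_ n x * g x| <= M * Kg.
  by move=> xab; rewrite normrM ler_pM// ?gK//; have [_ /(_ x)] := sP n.
have cv : \int[mu]_(x in `[a, b]) (s_ n x * g x) @[n --> \oo] -->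
    \int[mu]_(x in `[a, b]) (F x * g x).
  apply: (Rintegral_bounded_cvg ms _ sK); first exact: measurable_funM.
  (* The step functions are controlled only on the half-open interval, so the endpoint [b] joins the
     exceptional null set. *)
  have : mu.-negligible (~` [set x | {for x, continuous f} /\ F x = f x] `|` [set b]).
    by apply: negligibleU => //; apply/negligibleP => //; exact: lebesgue_measure_set1.
  apply: negligibleS => x /=; apply: contra_notP => /not_orP[/contrapT[cf ->] xb] xab.
  apply: cvgMl.
  apply/cvgrPdist_lt => e e0.
  have /cvgrPdist_lt/(_ _ e0)/nbhs_ballP[d /= d0 df] := cf.
  near=> n.
  have axb : a <= x < b.
    move: xab; rewrite in_itv/= => /andP[-> xb']/=; rewrite lt_neqAle xb' andbT; exact/eqP.
  have [_ _ /(_ _ axb)[y yx ->] _] := sP n.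
  apply: df; rewrite /ball/= distrC (lt_trans yx)//.
  by near: n; exact: near_infty_natSinv_lt (PosNum d0).
have /cvgrPdist_lt/(_ _ eps0)[n _ /(_ n (leqnn _))] := cv.
rewrite distrC; apply/negP; rewrite -leNgt.
have [msn _ _] := sP n; rewrite Rintegral_itv_bndo_bndc//.
apply: (bounded_measurable_integrable (a := a) (b := b) (K := M * Kg)) => //.
  exact: subset_itv_co_cc.
by move=> x xab; apply: sK; exact: (subset_itv_co_cc xab).
Unshelve. all: by end_near. Qed.

Lemma sum_by_parts (u x : nat -> R) (p : nat) :
  \sum_(k < p.+1) u k * (x k.+1 - x k) =
  u p * x p.+1 - u 0%N * x 0%N - \sum_(k < p) x k.+1 * (u k.+1 - u k).
Proof.
elim: p => [|p IH]; first by rewrite big_ord_recr !big_ord0/=; ring.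
by rewrite big_ord_recr/= IH [in RHS]big_ord_recr/=; ring.
Qed.

(* Summation by parts exchanges tags and nodes: the tags [tau], completed by
   [a] and [b], become the nodes, at the cost of doubling the mesh. *)
Lemma is_RS_integral_by_parts (f g : R -> R) (a b I : R) :
  is_RS_integral f g a b I ->
  is_RS_integral g f a b (f b * g b - f a * g a - I).
Proof.
move=> HI eps /HI[d d0 Hd]; exists (d / 2); first by rewrite divr_gt0.
move=> p t tau [t0 tp ht] mesh.
(* The new nodes are [a], [tau 0], ..., [tau (p - 1)], [b]: this makes [p.+1] cells, the [k]-th one
   tagged by the old node [t k]. For [p = 0] the single cell is degenerate, as then [a = b]. *)
pose t' k := if k is k'.+1 then if (k' < p)%N then tau k' else b else a.
have d2 : d / 2 + d / 2 = d by rewrite -splitr.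
have tinc k : (k < p)%N -> t k <= t k.+1.
  by move=> /ht/andP[]; exact: le_trans.
have tdist k : (k < p)%N -> t k.+1 - t k < d / 2.
  by move=> kp; have := mesh _ kp; rewrite ger0_norm ?subr_ge0 ?tinc.
have part : tagged_partition a b p.+1 t' t.
  split => //=; first by rewrite ltnn.
  case=> [|k]; rewrite ltnS => kp /=.
    rewrite t0 lexx/=; case: ifP => [/ht|]; first by rewrite t0 => /andP[].
    by move=> /negbT; rewrite -leqNgt leqn0 => /eqP p0; rewrite -t0 -tp p0.
  rewrite kp; have /andP[_ ->] /= := ht _ kp.
  case: ltnP => [/ht/andP[]//|pk].
  have -> : k.+1 = p by apply/eqP; rewrite eqn_leq pk kp.
  by rewrite tp.
have mesh' k : (k < p.+1)%N -> `|t' k.+1 - t' k| < d.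
  move=> kp; have [_ _ /(_ _ kp)/andP[h1 h2]] := part.
  rewrite ger0_norm ?subr_ge0 ?(le_trans h1)//.
  have h3 : t' k.+1 - t k < d / 2.
    rewrite /=; case: ltnP => [kp'|pk].
      have /andP[_ h] := ht _ kp'; have := tdist _ kp'; lra.
    have -> : k = p by apply/eqP; rewrite eqn_leq pk -ltnS kp.
    by rewrite tp subrr divr_gt0.
  have h4 : t k - t' k < d / 2.
    case: k kp {h1 h2 h3} => [|k] kp /=; first by rewrite t0 subrr divr_gt0.
    have kp' : (k < p)%N by [].
    rewrite kp'; have /andP[h _] := ht _ kp'; have := tdist _ kp'; lra.
  by rewrite -d2; lra.
have := Hd _ _ _ part mesh'; rewrite -normrN; congr (`|_| < _).
rewrite /RS_sum (sum_by_parts (fun k => f (t k)) (fun k => g (t' k))) /= ltnn t0 tp.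
have -> : \sum_(k < p) g (t' k.+1) * (f (t k.+1) - f (t k)) =
   \sum_(k < p) g (tau k) * (f (t k.+1) - f (t k)).
  by apply: eq_bigr => k _; rewrite /= ltn_ord.
by rewrite /=; lra.
Qed.

(** A uniform partition finer than both tolerances gives one sum lying at distance less than half of
    [|I - J|] from both values. *)
Lemma is_RS_integral_unique (g f : R -> R) (a b I J : R) : a <= b ->
  is_RS_integral g f a b I -> is_RS_integral g f a b J -> I = J.
Proof.
move=> ab HI HJ; apply/eqP; rewrite -subr_eq0 -normr_le0 leNgt; apply/negP => IJ.
have e0 : 0 < `|I - J| / 2 by rewrite divr_gt0.
have [d1 d10 H1] := HI _ e0; have [d2 d20 H2] := HJ _ e0.
pose d := Num.min d1 d2.
have d0 : 0 < d by rewrite lt_min d10.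
have [n bn] : exists n : nat, (b - a) / d < n%:R.
  by exists (Num.truncn ((b - a) / d)).+1; exact: truncnS_gt.
have n0 : 0 < n%:R :> R.
  by apply: le_lt_trans bn; rewrite divr_ge0// ?subr_ge0// ltW.
pose t k := a + (b - a) * (k%:R / n%:R).
have part : tagged_partition a b n t t.
  split; rewrite /t; first by rewrite mul0r mulr0 addr0.
    by rewrite divff ?gt_eqF// mulr1 addrC subrK.
  move=> k kn; rewrite lexx/= lerD2l; apply: ler_wpM2l; first by rewrite subr_ge0.
  by apply: ler_wpM2r; [rewrite invr_ge0 ltW|rewrite ler_nat].
have mesh k : `|t k.+1 - t k| < d.
  have -> : t k.+1 - t k = (b - a) / n%:R by rewrite /t -natr1; ring.
  rewrite ger0_norm ?divr_ge0 ?subr_ge0// ?ltW//.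
  by rewrite ltr_pdivrMr// mulrC -ltr_pdivrMr.
have := H1 _ _ _ part; have := H2 _ _ _ part.
move: (RS_sum _ _ _ _ _) => S h2 h1.
have {}h1 : `|S - I| < `|I - J| / 2.
  by apply: h1 => k _; apply: lt_le_trans (mesh k) _; rewrite ge_min lexx.
have {}h2 : `|S - J| < `|I - J| / 2.
  by apply: h2 => k _; apply: lt_le_trans (mesh k) _; rewrite ge_min lexx orbT.
have : `|I - J| <= `|S - I| + `|S - J|.
  by rewrite [`|S - I|]distrC; exact: ler_distD.
lra.
Qed.

Lemma RS_integralE (g f : R -> R) (a b I : R) : a <= b ->
  is_RS_integral g f a b I -> RS_integral g f a b = I.
Proof.
move=> ab HI; rewrite /RS_integral.
case: xgetP => [J _ /= HJ|/(_ I)//].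
exact: is_RS_integral_unique HJ HI.
Qed.

End RiemannStieltjesIntegral.

(** * Chords, and pointwise bounds for the Poisson kernel and its derivative *)

Section PoissonKernel.
Context {R : realType}.
Implicit Types r u v x y : R.

(** This is the distance between points of the unit circle at angle [x]. Unlike [|x|] it is
    [2 pi]-periodic, so estimates in terms of it can hold for all angles at once. *)
Definition chord x : R := 2 * `|sin (x / 2)|.

Lemma chord_ge0 x : 0 <= chord x.
Proof. by rewrite mulr_ge0. Qed.

Lemma sqr_chord x : chord x ^+ 2 = 2 - 2 * cos x.
Proof.
have -> : cos x = cos (x / 2 *+ 2) by congr cos; rewrite -mulr_natr divfK.
by rewrite cos_mulr2n cos2sin2 exprMn real_normK ?num_real//; ring.
Qed.

Lemma normr_sin_le_chord x : `|sin x| <= chord x.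
Proof.
have -> : sin x = 2 * (sin (x / 2) * cos (x / 2)).
  have -> : sin x = sin (x / 2 *+ 2) by congr sin; rewrite -mulr_natr divfK.
  by rewrite sin_mulr2n -mulr_natl mulrC [cos _ * _]mulrC; ring.
by rewrite !normrM normr_nat ler_pM2l// ler_piMr// cos_max.
Qed.

Lemma chord_triangle x y : chord (x + y) <= chord x + chord y.
Proof.
rewrite /chord [(x + y) / 2]mulrDl sinD -mulrDr ler_pM2l//.
apply: (le_trans (ler_normD _ _)); apply: lerD; rewrite normrM.
  by rewrite ler_piMr// cos_max.
by rewrite ler_piMl// cos_max.
Qed.

Lemma chordN x : chord (- x) = chord x.
Proof. by rewrite /chord mulNr sinN normrN. Qed.

(** The squared distance from [r e^(iu)] to 1. *)
Definition poisson_den r u : R := 1 - 2 * r * cos u + r ^+ 2.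

Lemma poisson_denE r u : poisson_den r u = (1 - r) ^+ 2 + r * chord u ^+ 2.
Proof. by rewrite sqr_chord /poisson_den; ring. Qed.

Lemma poisson_den_gt0 r u : 0 <= r < 1 -> 0 < poisson_den r u.
Proof.
move=> /andP[r0 r1]; rewrite poisson_denE ltr_wpDr ?mulr_ge0 ?sqr_ge0//.
by rewrite exprn_gt0// subr_gt0.
Qed.

Lemma poisson_kernel_ge0 r u : 0 <= r < 1 -> 0 <= poisson_kernel r u.
Proof.
move=> r01; have D0 := poisson_den_gt0 u r01.
rewrite divr_ge0 ?(ltW D0)// subr_ge0 expr_le1//; case/andP: r01 => // _ /ltW//.
Qed.

Definition poisson_deriv r u : R :=
  - ((1 - r ^+ 2) * (2 * r * sin u)) / poisson_den r u ^+ 2.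

Lemma is_derive_poisson_kernel r u : 0 <= r < 1 ->
  is_derive u (1 : R) (poisson_kernel r) (poisson_deriv r u).
Proof.
move=> r01; have D0 := lt0r_neq0 (poisson_den_gt0 u r01).
have dD : is_derive u (1 : R) (poisson_den r) (2 * r * sin u).
  have -> : poisson_den r = (fun x => 1 + r ^+ 2 + (- (2 * r)) *: cos x).
    by apply/funext => x; rewrite /poisson_den /GRing.scale/=; ring.
  apply: (is_derive_eq (is_deriveD (is_derive_cst (1 + r ^+ 2) u 1)
    (is_deriveZ (- (2 * r)) (is_derive_cos u)))).
  by rewrite /GRing.scale/=; ring.
apply: (is_derive_eq (is_deriveZ (1 - r ^+ 2) (is_deriveV D0 dD))).
by rewrite /poisson_deriv /GRing.scale/=; field.
Qed.

(** This is [u - 2 arg (1 - r e^(iu))]. Since [1 - r e^(iu)] has positive real part, the arctangent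
    gives its argument without jumps; that term is periodic, so the kernel has total mass [2 pi]. *)
Definition poisson_primitive r u : R :=
  u + 2 * atan (r * sin u / (1 - r * cos u)).

Lemma is_derive_poisson_primitive r u : 0 <= r < 1 ->
  is_derive u (1 : R) (poisson_primitive r) (poisson_kernel r u).
Proof.
move=> r01; have D0 := lt0r_neq0 (poisson_den_gt0 u r01).
have E0 : 1 - r * cos u != 0.
  rewrite gt_eqF// subr_gt0; have /andP[r0 r1] := r01.
  by apply: le_lt_trans r1; rewrite ler_piMr// cos_le1.
have dE : is_derive u (1 : R) (fun x => 1 - r * cos x) (r * sin u).
  have -> : (fun x => 1 - r * cos x) = (fun x => 1 + (- r) *: cos x).
    by apply/funext => x; rewrite /GRing.scale/=; ring.
  apply: (is_derive_eq (is_deriveD (is_derive_cst (1 : R) u 1)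
    (is_deriveZ (- r) (is_derive_cos u)))).
  by rewrite /GRing.scale/=; ring.
have dN : is_derive u (1 : R) (fun x => r * sin x) (r * cos u).
  exact: is_deriveZ.
have dq := is_deriveM dN (@is_deriveV _ (fun x => 1 - r * cos x) _ _ _ E0 dE).
have da := is_derive1_comp (is_derive1_atan _) dq.
apply: (is_derive_eq (is_deriveD (is_derive_id u (1 : R)) (is_deriveZ 2 da))).
rewrite /GRing.scale/= /poisson_kernel.
have s2 := sin2cos2 u.
have -> : ((fun x => r * sin x) * (fun y => (1 - r * cos y)^-1)) u =
  r * sin u / (1 - r * cos u) by [].
have -> : 1 + (r * sin u / (1 - r * cos u)) ^+ 2 =
    poisson_den r u / (1 - r * cos u) ^+ 2.
  by rewrite expr_div_n exprMn s2 /poisson_den; field.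
have -> : r * sin u * (- (1 - r * cos u) ^- 2 * (r * sin u)) =
   - (r ^+ 2 * sin u ^+ 2) / (1 - r * cos u) ^+ 2 by field.
rewrite s2 -/(poisson_den r u).
have -> : (1 - r ^+ 2) = poisson_den r u + 2 * (r * cos u - r ^+ 2).
  by rewrite /poisson_den; ring.
by field; rewrite D0.
Qed.

Lemma poisson_primitiveD2pi r u :
  poisson_primitive r (u + 2 * pi) = poisson_primitive r u + 2 * pi.
Proof.
by rewrite /poisson_primitive mulr_natl sinD2pi cosD2pi; ring.
Qed.

Lemma continuous_poisson_deriv r : 0 <= r < 1 -> continuous (poisson_deriv r).
Proof.
move=> r01 u; have D0 := lt0r_neq0 (poisson_den_gt0 u r01).
apply: cvgM.
  apply: cvgN; apply: cvgM; first exact: cvg_cst.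
  by apply: cvgM; [exact: cvg_cst|exact: continuous_sin].
apply: cvgV; first by rewrite expf_neq0.
apply: (@cvg_comp _ _ _ (poisson_den r) (fun x => x ^+ 2)); last exact: exprn_continuous.
apply: cvgD; last exact: cvg_cst.
apply: cvgB; first exact: cvg_cst.
by apply: cvgM; [exact: cvg_cst|exact: continuous_cos].
Qed.

Lemma continuous_poisson_kernel r : 0 <= r < 1 -> continuous (poisson_kernel r).
Proof.
move=> r01 u; apply: differentiable_continuous; apply/derivable1_diffP.
by case: (is_derive_poisson_kernel u r01).
Qed.

(** The lemma serves with [u = th - t] and [v = t - t0], where [C * (1 - r)] bounds the chord of
    [th - t0]. After clearing denominators and using [|sin u| <= chord u], a quadratic inequality in
    [1 - r] and [chord u] remains. *)
Lemma poisson_deriv_chord r u v (C : R) : 0 <= r < 1 -> 0 <= C ->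
  chord v <= chord u + C * (1 - r) ->
  `|poisson_deriv r u| * chord v <= (2 + C) * poisson_kernel r u.
Proof.
move=> /[dup] r01 /andP[r0 r1] C0 cv.
have D0 := poisson_den_gt0 u r01.
have r21 : 0 <= 1 - r ^+ 2 by rewrite subr_ge0 expr_le1// ltW.
rewrite /poisson_deriv mulNr normrN normrM normfV (ger0_norm (sqr_ge0 _)).
rewrite normrM (ger0_norm r21) normrM (ger0_norm (mulr_ge0 _ r0))//.
set D := poisson_den r u.
have -> : (2 + C) * poisson_kernel r u = (1 - r ^+ 2) * ((2 + C) * D) / D ^+ 2.
  by rewrite /poisson_kernel -/(poisson_den r u) -/D; field; rewrite gt_eqF.
rewrite mulrAC ler_pM2r ?invr_gt0 ?exprn_gt0// -!mulrA.
apply: ler_wpM2l => //.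
apply: (@le_trans _ _ (2 * (r * (chord u * (chord u + C * (1 - r)))))).
  do 2 apply: ler_wpM2l => //.
  by apply: ler_pM => //; [exact: chord_ge0|exact: normr_sin_le_chord].
rewrite /D poisson_denE; move: (chord_ge0 u); set c := chord u => c0.
(* The right side minus the left side is exactly the sum of the quantities in [h1] and [h2] and
   twice that in [h3]. *)
have h1 : 0 <= C * ((1 - r) - r * c) ^+ 2 by rewrite mulr_ge0// sqr_ge0.
have h2 : 0 <= C * (r * (1 - r)) * c ^+ 2.
  by rewrite mulr_ge0 ?sqr_ge0// mulr_ge0// mulr_ge0// subr_ge0 ltW.
have h3 : 0 <= (1 - r) ^+ 2 by rewrite sqr_ge0.
nra.
Qed.

(** The numerator of the kernel is at most [2 (1 - r)], and for [r >= 1 / 2] its denominator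
    dominates both [(1 - r)^2] and half of [chord u ^+ 2]; these two control [chord v ^+ 2]. *)
Lemma poisson_kernel_sqr_chord r u v (C : R) : 1 / 2 <= r < 1 -> 0 <= C ->
  chord v <= chord u + C * (1 - r) ->
  poisson_kernel r u * chord v ^+ 2 <= (8 + 4 * C ^+ 2) * (1 - r).
Proof.
move=> /andP[r2 r1] C0 cv.
have r01 : 0 <= r < 1 by rewrite r1 andbT; lra.
have D0 := poisson_den_gt0 u r01.
rewrite /poisson_kernel -/(poisson_den r u) mulrAC ler_pdivrMr//.
move: D0; rewrite poisson_denE => D0.
have v2 : chord v ^+ 2 <= 2 * chord u ^+ 2 + 2 * C ^+ 2 * (1 - r) ^+ 2.
  apply: (@le_trans _ _ ((chord u + C * (1 - r)) ^+ 2)).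
    by rewrite ler_sqr ?nnegrE ?chord_ge0// (le_trans _ cv)// chord_ge0.
  have := sqr_ge0 (chord u - C * (1 - r)); nra.
apply: (@le_trans _ _ ((1 - r ^+ 2) * (2 * chord u ^+ 2 + 2 * C ^+ 2 * (1 - r) ^+ 2))).
  by apply: ler_wpM2l v2; rewrite subr_ge0 expr_le1//; lra.
rewrite -subr_ge0; set c := chord u.
have -> : (8 + 4 * C ^+ 2) * (1 - r) * ((1 - r) ^+ 2 + r * c ^+ 2) -
    (1 - r ^+ 2) * (2 * c ^+ 2 + 2 * C ^+ 2 * (1 - r) ^+ 2) =
  (1 - r) * ((6 * r - 2) * c ^+ 2 + 8 * (1 - r) ^+ 2 +
    2 * (1 - r) * (C * (1 - r)) ^+ 2 + 4 * r * (C * c) ^+ 2) by ring.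
apply: mulr_ge0; first by lra.
by rewrite !addr_ge0// mulr_ge0 ?sqr_ge0//; lra.
Qed.

End PoissonKernel.

(** * The Poisson-Stieltjes integral as a Lebesgue integral, and its distance from [2 pi L] *)

Section PoissonEstimate.
Context {R : realType}.
Local Notation mu := (@lebesgue_measure R).
Variables (r th : R).
Hypothesis r01 : 0 <= r < 1.

Let h (t : R) : R := poisson_kernel r (th - t).
Let dh (t : R) : R := - poisson_deriv r (th - t).

Let is_derive_reflect (f : R -> R) (t df : R) :
  is_derive (th - t) (1 : R) f df -> is_derive t (1 : R) (fun x => f (th - x)) (- df).
Proof.
move=> fD; have D : is_derive t (1 : R) (fun x => th - x) (-1).
  apply: (is_derive_eq (is_deriveB (is_derive_cst th t 1) (is_derive_id t (1 : R)))).
  by rewrite sub0r.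
by apply: (is_derive_eq (@is_derive1_comp _ f (fun x => th - x) t _ _ fD D)); rewrite mulrN1.
Qed.

Let is_derive_h (t : R) : is_derive t (1 : R) h (dh t).
Proof. exact: is_derive_reflect (is_derive_poisson_kernel _ r01). Qed.

Let cvg_reflect (t : R) : th - x @[x --> t] --> th - t.
Proof. by apply: cvgB; [exact: cvg_cst|exact: cvg_id]. Qed.

Let continuous_h : continuous h.
Proof.
move=> t; apply: (cvg_comp _ _ (@cvg_reflect t)).
exact: (continuous_poisson_kernel r01).
Qed.

Let continuous_dh : continuous dh.
Proof.
move=> t; apply: cvgN; apply: (cvg_comp _ _ (@cvg_reflect t)).
exact: (continuous_poisson_deriv r01).
Qed.

Let h_pi : h pi = h (- pi).
Proof.
rewrite /h /poisson_kernel opprK.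
have -> : th + pi = th - pi + pi *+ 2 by ring.
by rewrite cosD2pi.
Qed.

Let H (t : R) : R := - poisson_primitive r (th - t).

Let is_derive_H (t : R) : is_derive t (1 : R) H (h t).
Proof.
apply: (is_derive_eq (is_deriveN (is_derive_reflect (is_derive_poisson_primitive (th - t) r01)))).
by rewrite opprK.
Qed.

Let H_pi : H pi = H (- pi) + 2 * pi.
Proof.
rewrite /H opprK; have -> : th + pi = th - pi + 2 * pi by ring.
by rewrite poisson_primitiveD2pi; ring.
Qed.

Lemma is_RS_integral_poisson (Phi F : R -> R) (M : R) :
  periodic Phi (2 * pi) -> (forall x, `|Phi x| <= M) -> measurable_fun setT F ->
  {ae mu, forall x, {for x, continuous Phi} /\ F x = Phi x} ->
  is_RS_integral h Phi (- pi) pi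
    (- (\int[mu]_(t in `[- pi, pi]) (F t * dh t))).
Proof.
move=> perPhi PhiM mF aeF.
have := is_RS_integral_by_parts
  (is_RS_integral_Rintegral (- pi) pi is_derive_h continuous_dh PhiM mF aeF).
have -> : Phi pi = Phi (- pi) by rewrite -[RHS]perPhi; congr Phi; ring.
by rewrite h_pi subrr sub0r.
Qed.

Lemma poisson_integral_estimate (F : R -> R) (t0 L c0 eps K C M : R) :
  1 / 2 <= r -> 0 <= C -> 0 <= eps -> 0 <= K ->
  measurable_fun setT F -> (forall x, `|F x| <= M) ->
  chord (th - t0) <= C * (1 - r) ->
  (forall t, `|F t - c0 - L * sin (t - t0)| <=
     eps * chord (t - t0) + K * chord (t - t0) ^+ 3) ->
  `|- (\int[mu]_(t in `[- pi, pi]) (F t * dh t)) - 2 * pi * L| <=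
  2 * pi * (eps * (2 + C) + (K * (2 + C) + `|L|) * (8 + 4 * C ^+ 2) * (1 - r)).
Proof.
move=> r2 C0 eps0 K0 mF FM cth Fb.
have pi0 : - pi <= pi :> R by have := pi_ge0 R; lra.
pose S (t : R) : R := sin (t - t0).
pose T (t : R) : R := cos (t - t0).
have dS (t : R) : is_derive t (1 : R) S (T t).
  have D : is_derive t (1 : R) (fun x => x - t0) 1.
    apply: (is_derive_eq (is_deriveB (is_derive_id t (1 : R)) (is_derive_cst t0 t 1))).
    by rewrite subr0.
  apply: (is_derive_eq (@is_derive1_comp _ (@sin R) (fun x => x - t0) t _ _ (is_derive_sin _) D)).
  by rewrite mulr1.
have cvs (t : R) : x - t0 @[x --> t] --> t - t0.
  by apply: cvgB; [exact: cvg_id|exact: cvg_cst].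
have cS : continuous S.
  by move=> t; apply: (cvg_comp _ _ (cvs t)); exact: continuous_sin.
have cT : continuous T.
  by move=> t; apply: (cvg_comp _ _ (cvs t)); exact: continuous_cos.
(* The derivative of [G] is [(c0 + L S) dh - L (1 - T) h]: the model of [F] against [dh], corrected
   by a term with [1 - T = chord^2 / 2]. The terms in [h] are periodic and [H] grows by [2 pi], so
   the integral of [k] is exactly [- 2 pi L]. *)
pose G (t : R) : R := c0 * h t + L * (S t * h t) + (- L) * H t.
pose k (t : R) : R := c0 * dh t + L * (S t * dh t + h t * T t) + (- L) * h t.
have dG (t : R) : is_derive t (1 : R) G (k t).
  exact: (is_deriveD (is_deriveD (is_deriveZ c0 (is_derive_h t))
    (is_deriveZ L (is_deriveM (dS t) (is_derive_h t))))
    (is_deriveZ (- L) (is_derive_H t))).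
have ck : continuous k.
  move=> t; apply: cvgD; last first.
    by apply: cvgM; [exact: cvg_cst|exact: continuous_h].
  apply: cvgD; first by apply: cvgM; [exact: cvg_cst|exact: continuous_dh].
  apply: cvgM; first exact: cvg_cst.
  apply: cvgD; apply: cvgM; [exact: cS|exact: continuous_dh|exact: continuous_h|exact: cT].
have ik : \int[mu]_(t in `[- pi, pi]) k t = - (2 * pi * L).
  rewrite (Rintegral_is_derive pi0 dG ck) /G h_pi H_pi.
  have -> : S pi = S (- pi).
    rewrite /S; have -> : pi - t0 = - pi - t0 + pi *+ 2 by ring.
    by rewrite sinD2pi.
  by ring.
have [Kd dK] := continuous_bounded_segment (- pi) pi continuous_dh.
have iF : mu.-integrable `[- pi, pi] (EFin \o (fun t => F t * dh t)).
  apply: (bounded_measurable_integrable (a := - pi) (b := pi) (K := M * Kd)) => //.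
    by apply: measurable_funM => //; exact: continuous_measurable_fun.
  by move=> t tab; rewrite normrM ler_pM// dK.
have iki := continuous_integrable_segment (- pi) pi ck.
have -> : - (\int[mu]_(t in `[- pi, pi]) (F t * dh t)) - 2 * pi * L =
    \int[mu]_(t in `[- pi, pi]) (k t - F t * dh t).
  by rewrite RintegralB// ik addrC.
set kappa := (K * (2 + C) + `|L|) * (8 + 4 * C ^+ 2) * (1 - r).
(* A pointwise majorant of [|k - F dh|] whose integral over a period is the claimed bound. *)
pose B (t : R) : R := eps * (2 + C) * h t + kappa.
have cB : continuous B.
  move=> t; apply: cvgD; last exact: cvg_cst.
  by apply: cvgM; [exact: cvg_cst|exact: continuous_h].
have dB (t : R) : is_derive t (1 : R) (fun t => eps * (2 + C) * H t + kappa * t) (B t).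
  apply: (is_derive_eq (is_deriveD (is_deriveZ (eps * (2 + C)) (is_derive_H t))
    (is_deriveZ kappa (is_derive_id t (1 : R))))).
  by rewrite /GRing.scale/= mulr1.
have -> : 2 * pi * (eps * (2 + C) + kappa) = \int[mu]_(t in `[- pi, pi]) B t.
  by rewrite (Rintegral_is_derive pi0 dB cB) H_pi; ring.
have iD : mu.-integrable `[- pi, pi] (EFin \o (fun t => k t - F t * dh t)).
  have [Kk kK] := continuous_bounded_segment (- pi) pi ck.
  apply: (bounded_measurable_integrable (a := - pi) (b := pi) (K := Kk + M * Kd)) => //.
    apply: measurable_funB; first exact: continuous_measurable_fun.
    by apply: measurable_funM => //; exact: continuous_measurable_fun.
  by move=> t tab; rewrite (le_trans (ler_normB _ _))// lerD ?kK// normrM ler_pM// dK.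
apply: (le_trans (le_normr_Rintegral _ iD)) => //.
apply: le_Rintegral => //.
- by apply: integrable_norm.
- exact: continuous_integrable_segment.
move=> t _.
have ctv : chord (t - t0) <= chord (th - t) + C * (1 - r).
  have -> : t - t0 = - (th - t) + (th - t0) by ring.
  by rewrite (le_trans (chord_triangle _ _))// chordN lerD2l.
have b1 := poisson_deriv_chord r01 C0 ctv.
have b2 : h t * chord (t - t0) ^+ 2 <= (8 + 4 * C ^+ 2) * (1 - r).
  by apply: poisson_kernel_sqr_chord => //; rewrite r2; case/andP: r01.
have h0 : 0 <= h t := poisson_kernel_ge0 _ r01.
have c2 := sqr_chord (t - t0).
have -> : k t - F t * dh t =
    - ((F t - c0 - L * S t) * dh t) - L * (chord (t - t0) ^+ 2 / 2 * h t).
  by rewrite c2 /k -/(T t); field.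
have := Fb t; rewrite -/(S t); set Psi := F t - c0 - L * S t => PsiB.
have {b1} : `|dh t| * chord (t - t0) <= (2 + C) * h t by rewrite normrN.
have := chord_ge0 (t - t0); move: PsiB b2 {c2 ctv}; set c := chord (t - t0).
move=> PsiB b2 cge0 b1.
have Lc : `|L * (c ^+ 2 / 2 * h t)| = `|L| * (c ^+ 2 / 2 * h t).
  by rewrite normrM [X in _ * X = _]ger0_norm// mulr_ge0// divr_ge0// sqr_ge0.
apply: (le_trans (ler_normB _ _)); rewrite normrN [`|Psi * _|]normrM Lc.
(* One factor [c] turns [|dh|] into a multiple of [h]. In the cubic term a factor [c ^+ 2] is left
   over, which [b2] then absorbs. *)
have e1 : `|Psi| * `|dh t| <= eps * ((2 + C) * h t) + K * ((2 + C) * (h t * c ^+ 2)).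
  apply: (@le_trans _ _ ((eps * c + K * c ^+ 3) * `|dh t|)); first exact: ler_wpM2r.
  have -> : (eps * c + K * c ^+ 3) * `|dh t| =
    eps * (`|dh t| * c) + K * (`|dh t| * c * c ^+ 2) by ring.
  apply: lerD; apply: ler_wpM2l => //.
  by rewrite [leRHS]mulrA; apply: ler_wpM2r => //; exact: sqr_ge0.
have e2 : K * ((2 + C) * (h t * c ^+ 2)) <= K * ((2 + C) * ((8 + 4 * C ^+ 2) * (1 - r))).
  by do 2 apply: ler_wpM2l => //; lra.
have e3 : `|L| * (c ^+ 2 / 2 * h t) <= `|L| * ((8 + 4 * C ^+ 2) * (1 - r)).
  apply: ler_wpM2l => //; apply: le_trans b2; rewrite mulrC; apply: ler_wpM2l => //.
  by have := sqr_ge0 c; lra.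
rewrite /B /kappa.
have -> : eps * (2 + C) * h t + (K * (2 + C) + `|L|) * (8 + 4 * C ^+ 2) * (1 - r) =
  eps * ((2 + C) * h t) + K * ((2 + C) * ((8 + 4 * C ^+ 2) * (1 - r)))
  + `|L| * ((8 + 4 * C ^+ 2) * (1 - r)) by ring.
by apply: lerD => //; apply: (le_trans e1); rewrite lerD2l.
Qed.

End PoissonEstimate.

(** * First-order expansion of a periodic function, with a global error bound *)

Section ChordExpansion.
Context {R : realType}.
Implicit Types (x y : R).

Lemma is_derive_expansion (f : R -> R) x df : is_derive x (1 : R) f df ->
  forall e, 0 < e -> exists2 d, 0 < d & forall y, `|y| < d ->
    `|f (y + x) - f x - df * y| <= e * `|y|.
Proof.
move=> [/= /cvg_ex[l fl] dfE] e e0.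
have {dfE} ldf : l = df.
  by rewrite -dfE /derive; apply/esym; apply: cvg_lim fl.
move: fl; rewrite ldf => /cvgrPdist_le/(_ _ e0).
move=> -[d /= d0 H]; exists d => // y yd.
have [->|y0] := eqVneq y 0; first by rewrite add0r subrr mulr0 subrr normr0 mulr0.
have := H y; rewrite /ball/= sub0r normrN => /(_ yd y0).
rewrite /GRing.scale/= mulr1 => {}H.
have -> : f (y + x) - f x - df * y = - (y * (df - y^-1 * (f (y + x) - f x))).
  by field.
by rewrite normrN normrM mulrC ler_wpM2r.
Qed.

Lemma periodic_ind (P : R -> Prop) :
  (forall x, P x <-> P (x + 2 * pi)) -> (forall x, `|x| <= pi -> P x) ->
  forall x, P x.
Proof.
move=> perP H x.
have PN n y : P y <-> P (y + 2 * pi *+ n).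
  elim: n => [|n IH]; first by rewrite mulr0n addr0.
  by rewrite mulrSr addrA -perP.
have pi0 : 0 < pi :> R := pi_gt0 R.
(* Subtracting [k] periods brings [x] into the interval from [- pi] to [pi]. *)
pose k := Num.floor ((x + pi) / (2 * pi)).
have {}H : P (x - 2 * pi *~ k).
  apply: H.
  have /andP[k1 k2] : k%:~R <= (x + pi) / (2 * pi) < (k + 1)%:~R by rewrite floor_itv.
  move: k1 k2; rewrite ler_pdivlMr ?ltr_pdivrMr ?mulr_gt0// intrD.
  rewrite -[2 * pi *~ k]mulrzl.
  rewrite ler_norml => k1 k2; apply/andP; split; lra.
case: k H => n; first by move=> /(PN n); rewrite pmulrn subrK.
by rewrite NegzE mulrNz opprK -pmulrn => H; apply/(PN n.+1).
Qed.

Lemma chordD2pi x : chord (x + 2 * pi) = chord x.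
Proof.
rewrite /chord; have -> : (x + 2 * pi) / 2 = x / 2 + pi by field.
by rewrite sinDpi normrN.
Qed.

Lemma ler_chord x y : 0 <= x -> x <= `|y| -> `|y| <= pi -> chord x <= chord y.
Proof.
move=> x0 xy ypi.
have -> : chord y = chord `|y| by case: (ger0P y); rewrite ?chordN.
have pi0 : 0 < pi :> R := pi_gt0 R.
have s0 (z : R) : 0 <= z <= pi -> 0 <= sin (z / 2).
  by move=> /andP[z0 zpi]; apply: sin_ge0_pi; apply/andP; split; lra.
have y0 := normr_ge0 y.
rewrite /chord [`|sin (x / 2)|]ger0_norm; last by apply: s0; apply/andP; split; lra.
rewrite [`|sin (`|y| / 2)|]ger0_norm; last by apply: s0; apply/andP; split; lra.
rewrite ler_pM2l//; move: xy; rewrite le_eqVlt => /predU1P[->//|xy].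
have xI : x / 2 \in `[- (pi / 2), pi / 2] by rewrite in_itv/=; apply/andP; split; lra.
have yI : `|y| / 2 \in `[- (pi / 2), pi / 2] by rewrite in_itv/=; apply/andP; split; lra.
by apply: ltW; rewrite ltr_sin// ltr_pM2r.
Qed.

(** Close to [t0] differentiability gives the term linear in the chord. Elsewhere in the period the
    chord is bounded below, so a large [K] lets the cubic term swallow the bounded remainder. The
    exponent 3 leaves a square after one factor is spent on the derivative of the kernel. *)
Lemma chord_expansion (Phi : R -> R) (t0 L M eps : R) :
  periodic Phi (2 * pi) -> (forall x, `|Phi x| <= M) ->
  is_derive t0 (1 : R) Phi L -> 0 < eps ->
  exists2 K, 0 <= K & forall t,
    `|Phi t - Phi t0 - L * sin (t - t0)| <=
    eps * chord (t - t0) + K * chord (t - t0) ^+ 3.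
Proof.
move=> perPhi PhiM dPhi eps0.
have pi0 : 0 < pi :> R := pi_gt0 R.
have M0 : 0 <= M := le_trans (normr_ge0 _) (PhiM 0).
pose Psi x := Phi (x + t0) - Phi t0 - L * sin x.
have e4 : 0 < eps / 4 by rewrite divr_gt0.
have L1 : 0 < `|L| + 1 by rewrite ltr_wpDl.
(* The errors of [Phi] and of [L * (sin x - x)] each get [eps / 4] times [|x|]; [|L| + 1] keeps the
   division safe when [L = 0]. The third expansion, used at [x / 2], gives [|x| <= 2 * chord x], so
   the total is at most [eps * chord x]. *)
have [d1 d10 H1] := is_derive_expansion dPhi e4.
have [d2 d20 H2] := is_derive_expansion (is_derive_sin 0) (divr_gt0 e4 L1).
have [d3 d30 H3] := is_derive_expansion (is_derive_sin 0) (divr_gt0 ltr01 (ltr0Sn R 1)).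
pose d := Num.min (Num.min d1 d2) (Num.min d3 pi).
have d0 : 0 < d by rewrite !lt_min d10 d20 d30.
have dpi : d <= pi by rewrite !ge_min lexx !orbT.
have near0 x : `|x| < d -> `|Psi x| <= eps * chord x.
  rewrite !lt_min => /andP[/andP[x1 x2] /andP[x3 _]].
  have {}H1 := H1 _ x1.
  have {}H2 := H2 _ x2; rewrite addr0 sin0 cos0 subr0 mul1r in H2.
  have {}H3 : `|x| <= 2 * chord x.
    have x23 : `|x / 2| < d3.
      by rewrite normrM normfV normr_nat; have := normr_ge0 x; lra.
    have := H3 _ x23; rewrite addr0 sin0 cos0 subr0 mul1r.
    have := ler_normB (sin (x / 2)) (sin (x / 2) - x / 2).
    rewrite subKr /chord [`|x / 2|]normrM normfV normr_nat.
    lra.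
  have L2 : `|L * (sin x - x)| <= eps / 4 * `|x|.
    rewrite normrM; apply: (@le_trans _ _ (`|L| * (eps / 4 / (`|L| + 1) * `|x|))).
      exact: ler_wpM2l.
    rewrite mulrA ler_wpM2r// mulrCA ler_piMr ?ltW// ltr_pdivrMr// mul1r.
    by rewrite ltrDl.
  have -> : Psi x = (Phi (x + t0) - Phi t0 - L * x) - L * (sin x - x).
    by rewrite /Psi; ring.
  apply: (le_trans (ler_normB _ _)); apply: (le_trans (lerD H1 L2)).
  have -> : eps / 4 * `|x| + eps / 4 * `|x| = eps * (`|x| / 2) by field.
  by apply: ler_wpM2l; lra.
have PsiM x : `|Psi x| <= M + M + `|L|.
  rewrite /Psi (le_trans (ler_normB _ _))// lerD//.
    by rewrite (le_trans (ler_normB _ _))// lerD.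
  by rewrite normrM ler_piMr// sin_max.
have cd0 : 0 < chord d.
  by rewrite /chord mulr_gt0// normr_gt0 gt_eqF// sin_gt0_pi//; apply/andP; split; lra.
pose K := (M + M + `|L|) / chord d ^+ 3.
have K0 : 0 <= K by rewrite divr_ge0 ?addr_ge0// exprn_ge0// ltW.
exists K => // t.
suff H x : `|Psi x| <= eps * chord x + K * chord x ^+ 3.
  by have := H (t - t0); rewrite /Psi subrK.
elim/periodic_ind: x => [x|x xpi].
  suff -> : Psi (x + 2 * pi) = Psi x by rewrite chordD2pi.
  by rewrite /Psi [x + 2 * pi + t0]addrAC perPhi mulr_natl sinD2pi.
have c0 := chord_ge0 x.
have [xd|dx] := ltP `|x| d.
  by rewrite (le_trans (near0 _ xd))// lerDl mulr_ge0// exprn_ge0.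
apply: (le_trans (PsiM x)); rewrite -[leLHS]add0r lerD ?mulr_ge0 ?(ltW eps0)//.
rewrite /K mulrAC ler_pdivlMr ?exprn_gt0// ler_wpM2l ?addr_ge0//.
by rewrite lerXn2r ?nnegrE ?(ltW cd0)// ler_chord// ltW.
Qed.

End ChordExpansion.

(** * Polar coordinates, and the geometry of an angle inside the disk *)

Section Polar.
Context {R : realType}.

(** The angle [acos x] has the right cosine and sine [|y|], so the sign of [y] decides between it
    and its opposite. The value [- pi] cannot occur, since it would force [y = 0] in the case
    [y < 0]. *)
Lemma circle_angle (x y : R) : x ^+ 2 + y ^+ 2 = 1 ->
  exists2 th, - pi < th <= pi & x = cos th /\ y = sin th.
Proof.
move=> xy1.
have x1 : -1 <= x <= 1 by rewrite -ler_norml -(@expr_le1 _ 2)// real_normK ?num_real//; nra.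
have pi0 : 0 < pi :> R := pi_gt0 R.
have sE : sin (acos x) = `|y|.
  by rewrite sin_acos// -xy1 addrAC subrr add0r sqrtr_sqr.
have cE : cos (acos x) = x by rewrite acosK// in_itv.
have := acos_ge0 x1; have := acos_lepi x1 => api a0.
have [y0|y0] := lerP 0 y.
  exists (acos x); first by rewrite api andbT; lra.
  by rewrite sE cE ger0_norm.
exists (- acos x); last by rewrite cosN sinN sE cE ltr0_norm// opprK.
apply/andP; split; last by lra.
rewrite ltrN2 lt_neqAle api andbT; apply/eqP => E.
by move: sE; rewrite E sinpi => /esym/eqP; rewrite normr_eq0 => /eqP yE; move: y0; rewrite yE ltxx.
Qed.

Lemma normr_ComplexE (x y : R) : `|(Complex x y : Cplx R)| = ((Num.sqrt (x ^+ 2 + y ^+ 2))%:C)%C.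
Proof. by rewrite [LHS]normc_def. Qed.

Lemma modulusE (x y : R) : modulus (Complex x y : Cplx R) = Num.sqrt (x ^+ 2 + y ^+ 2).
Proof. by rewrite /modulus normr_ComplexE. Qed.

Lemma modulus_ge0 (z : Cplx R) : 0 <= modulus z.
Proof. by case: z => x y; rewrite modulusE sqrtr_ge0. Qed.

Lemma normr_modulus (z : Cplx R) : `|z| = ((modulus z)%:C)%C.
Proof. by case: z => x y; rewrite modulusE normr_ComplexE. Qed.

Lemma modulus_polar (r th : R) : 0 <= r -> modulus (polar r th) = r.
Proof.
by move=> r0; rewrite modulusE !exprMn -mulrDr cos2Dsin2 mulr1 sqrtr_sqr ger0_norm.
Qed.

(** The set from which [argument] chooses is never empty, so the default of [xget] is never taken;
    at [z = 0] the angle 0 is a witness. *)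
Lemma polar_argument (z : Cplx R) : z = polar (modulus z) (argument z).
Proof.
rewrite /argument; case: xgetP => [th _ [_]//|N]; exfalso.
case: z N => x y; rewrite modulusE; set r := Num.sqrt _ => N.
have r2 : r ^+ 2 = x ^+ 2 + y ^+ 2 by rewrite sqr_sqrtr// addr_ge0// sqr_ge0.
have [r0|r0] := eqVneq r 0.
  move: r2; rewrite r0 expr0n/= => /esym/eqP.
  rewrite paddr_eq0 ?sqr_ge0// !sqrf_eq0 => /andP[/eqP x0 /eqP y0].
  apply: (N 0); split; last by rewrite /polar x0 y0 r0 !mul0r.
  by have := pi_gt0 R => pi0; apply/andP; split; lra.
have [|th thpi [xE yE]] := @circle_angle (x / r) (y / r).
  by rewrite !expr_div_n -mulrDl -r2 divff// expf_neq0.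
by apply: (N th); split => //; rewrite /polar -xE -yE; congr Complex; field.
Qed.

Lemma unit_diskP (z : Cplx R) : unit_disk z <-> modulus z < 1.
Proof. by rewrite /unit_disk/= normr_modulus (_ : 1 = (1%:C)%C)// ltcR. Qed.

Lemma sqr_modulus_polarD (t0 rho phi : R) :
  modulus (polar 1 t0 + polar rho phi) ^+ 2 =
  1 + rho ^+ 2 + 2 * rho * cos (phi - t0).
Proof.
rewrite modulusE sqr_sqrtr ?addr_ge0 ?sqr_ge0//.
by rewrite cosB; have := cos2Dsin2 t0; have := cos2Dsin2 phi; nra.
Qed.

(** Both sides are the squared distance between the point and the vertex [e^(i t0)]. *)
Lemma sqr_dist_polar (r th t0 rho phi : R) :
  polar r th = polar 1 t0 + polar rho phi ->
  rho ^+ 2 = (1 - r) ^+ 2 + r * chord (th - t0) ^+ 2.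
Proof.
case=> E1 E2; rewrite sqr_chord cosB.
have e1 : rho * cos phi = r * cos th - cos t0 by rewrite E1; ring.
have e2 : rho * sin phi = r * sin th - sin t0 by rewrite E2; ring.
have -> : rho ^+ 2 = (rho * cos phi) ^+ 2 + (rho * sin phi) ^+ 2.
  by rewrite !exprMn -mulrDr cos2Dsin2 mulr1.
by rewrite e1 e2; have := cos2Dsin2 t0; have := cos2Dsin2 th; nra.
Qed.

(** The point at distance [d / 2] on the same ray lies in the disk, which forces
    [2 cos (phi - t0) < - d / 2] uniformly in [phi]. Hence [modulus z ^+ 2 <= 1 - rho d / 4] for
    [rho <= d / 4], so [rho <= (8 / d) (1 - modulus z)], while the chord is at most [2 rho] because
    [modulus z >= 1 / 2]. *)
Lemma angle_in_disk_chord (t0 alpha beta d rho phi : R) (z : Cplx R) :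
  angle_at (polar 1 t0) alpha beta d `<=` @unit_disk R ->
  0 < d -> alpha < phi < beta -> 0 < rho -> rho <= d / 4 -> rho <= 1 / 2 ->
  z = polar 1 t0 + polar rho phi ->
  1 - rho <= modulus z < 1 /\
  chord (argument z - t0) <= 16 / d * (1 - modulus z).
Proof.
move=> sub d0 phiab rho0 rhod rho2 zE.
have r0 := modulus_ge0 z; set r := modulus z in r0 *.
have r1 : r < 1.
  by apply/unit_diskP/sub; exists rho, phi; split => //; apply/andP; split => //; lra.
have : unit_disk (polar 1 t0 + polar (d / 2) phi).
  by apply: sub; exists (d / 2), phi; split => //; apply/andP; split; lra.
move=> /unit_diskP; rewrite -(@expr_lt1 _ 2) ?modulus_ge0// sqr_modulus_polarD => cd.
have {cd} cd : 2 * cos (phi - t0) < - (d / 2) by nra.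
have := sqr_modulus_polarD t0 rho phi; rewrite -zE -/r => r2.
have := @sqr_dist_polar r (argument z) t0 rho phi; rewrite -polar_argument => /(_ zE) rho2E.
have rhor : 1 - rho <= r.
  have : (1 - r) ^+ 2 <= rho ^+ 2 by rewrite rho2E lerDl mulr_ge0 ?sqr_ge0.
  by rewrite ler_sqr ?nnegrE; lra.
split; first by rewrite rhor.
have rhoC : rho <= 8 / d * (1 - r).
  rewrite mulrAC ler_pdivlMr//.
  have : r ^+ 2 <= 1 - rho * (d / 4) by nra.
  nra.
have -> : 16 / d * (1 - r) = 2 * (8 / d * (1 - r)) by field; rewrite gt_eqF.
apply: (@le_trans _ _ (2 * rho)); last by rewrite ler_pM2l.
rewrite -ler_sqr ?nnegrE ?chord_ge0 ?mulr_ge0 ?(ltW rho0)//.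
have : 1 / 2 * chord (argument z - t0) ^+ 2 <= r * chord (argument z - t0) ^+ 2.
  by apply: ler_wpM2r; [exact: sqr_ge0|lra].
have := sqr_ge0 (1 - r); have := sqr_ge0 rho; rewrite [(2 * rho) ^+ 2]exprMn; lra.
Qed.

End Polar.

(** * The angular limit *)

Theorem theorem1 (R : realType) (Phi : R -> R) (t0 : R) :
  periodic Phi (2 * pi) ->
  bounded_fun Phi ->
  lebesgue_measure.-negligible [set x : R | ~ {for x, continuous Phi}] ->
  derivable Phi t0 1 ->
  angular_limit (poisson_stieltjes Phi) (polar 1 t0) (derive1 Phi t0).
Proof.
move=> perPhi [M0 [_ bndPhi]] [A [mA A0 contA]] dPhi gamma [_ gdisk gcvg].
move=> [alpha [beta [d [d0 sub gangle]]]].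
set L := derive1 Phi t0.
have dL : is_derive t0 (1 : R) Phi L.
  by rewrite /L derive1E; exact: derivableP.
pose M := M0 + 1.
have PhiM x : `|Phi x| <= M by apply: (bndPhi M) => //; rewrite ltrDl.
pose C : R := 16 / d.
have C0 : 0 <= C by rewrite divr_ge0// ltW.
pose S x := Phi t0 + L * sin (x - t0).
(* [F] equals [Phi] off the null set [A]; its value [S] on [A] makes it
   measurable while keeping the bound of [chord_expansion] at every point. *)
pose F x := S x + ((fun x => Phi x - S x) \_ (~` A)) x.
have pi0 := pi_gt0 R.
have cS : continuous S.
  move=> x; apply: cvgD; first exact: cvg_cst.
  apply: cvgM; first exact: cvg_cst.
  apply: (@cvg_comp _ _ _ (fun x => x - t0) (@sin R)); last exact: continuous_sin.
  by apply: cvgB; [exact: cvg_id|exact: cvg_cst].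
have mS : measurable_fun setT S by exact: continuous_measurable_fun.
have mAC : measurable (~` A) by exact: measurableC.
have mF : measurable_fun setT F.
  apply: measurable_funD => //; apply/(measurable_restrictT _ mAC).
  apply: measurable_funB; last exact: measurable_funS mS.
  apply: subspace_continuous_measurable_fun => //.
  apply: continuous_in_subspaceT => x; rewrite inE => xA.
  by apply: contrapT => nc; apply: xA; exact: contA.
have FPhi x : ~ A x -> F x = Phi x.
  by move=> xA; rewrite /F patchE mem_set// addrC subrK.
have FS x : A x -> F x = S x.
  by move=> xA; rewrite /F patchE memNset ?addr0//; exact.
have aeF : {ae lebesgue_measure, forall x, {for x, continuous Phi} /\ F x = Phi x}.
  exists A; split => // x /=; apply: contra_notP => xA; split; last exact: FPhi.
  by apply: contrapT => nc; apply: xA; exact: contA.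
have SM x : `|S x| <= M + `|L|.
  by rewrite (le_trans (ler_normD _ _))// lerD// normrM ler_piMr// sin_max.
have FM x : `|F x| <= M + `|L|.
  have [/FS->//|/FPhi->] := pselect (A x).
  by rewrite (le_trans (PhiM x))// lerDl.
apply/cvgrPdist_le => e e0.
(* Chosen so that [eps * (2 + C)] is half of [e]. *)
pose eps := e / (2 * (2 + C)).
have eps0 : 0 < eps by rewrite divr_gt0// mulr_gt0// ltr_wpDr.
have [K K0 PhiK] := chord_expansion perPhi PhiM dL eps0.
pose W := (K * (2 + C) + `|L|) * (8 + 4 * C ^+ 2).
have W0 : 0 <= W.
  by rewrite mulr_ge0// addr_ge0// mulr_ge0 ?sqr_ge0// addr_ge0.
(* The first two bounds allow [angle_in_disk_chord] and give [r >= 1 / 2]. Since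
   [1 - r <= rho < eta], the third makes [W * (1 - r)] at most [e / 2]; [W + 1] avoids a zero
   denominator. *)
pose eta := Num.min (Num.min (d / 4) (1 / 2)) (e / (2 * (W + 1))).
have eta0 : 0 < eta.
  by rewrite !lt_min !divr_gt0// mulr_gt0// ltr_wpDl.
(* On [A] the left side vanishes, [F] being the model [S] there. *)
have FK t : `|F t - Phi t0 - L * sin (t - t0)| <=
    eps * chord (t - t0) + K * chord (t - t0) ^+ 3.
  have [/FS->|/FPhi->//] := pselect (A t).
  have -> : S t - Phi t0 - L * sin (t - t0) = 0 by rewrite /S; ring.
  by rewrite normr0 addr_ge0// mulr_ge0 ?exprn_ge0 ?chord_ge0// ltW.
have key (s : R) : 0 <= s < 1 -> `|polar 1 t0 - gamma s| < (eta%:C)%C ->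
    angle_at (polar 1 t0) alpha beta d (gamma s) ->
    `|L - poisson_stieltjes Phi (gamma s)| <= e.
  move=> s01 gs [rho [phi [/andP[rho0 rhod] phiab gE]]].
  have {gs} rho_eta : rho < eta.
    move: gs; rewrite gE opprD addrA subrr sub0r normrN normr_modulus ltcR.
    by rewrite modulus_polar// ltW.
  move: (rho_eta); rewrite !lt_min => /andP[/andP[rho4 rho2] rhoW].
  have [/andP[r1 r2] cth] := angle_in_disk_chord sub d0 phiab rho0 (ltW rho4) (ltW rho2) gE.
  set r := modulus (gamma s) in r1 r2 cth.
  set th := argument (gamma s) in cth.
  have r01 : 0 <= r < 1 by rewrite modulus_ge0.
  have rh : 1 / 2 <= r by lra.
  have HI := is_RS_integral_poisson th r01 perPhi PhiM mF aeF.
  have pp : - pi <= pi :> R by lra.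
  have := poisson_integral_estimate r01 rh C0 (ltW eps0) K0 mF FM cth FK.
  rewrite /poisson_stieltjes (RS_integralE pp HI).
  set I := - _ => HE.
  have -> : L - (2 * pi)^-1 * I = - ((2 * pi)^-1 * (I - 2 * pi * L)).
    by rewrite mulrBr mulKf ?opprB// gt_eqF// mulr_gt0.
  rewrite normrN normrM ger0_norm ?invr_ge0 ?mulr_ge0 ?(ltW pi0)//.
  rewrite ler_pdivrMl ?mulr_gt0//; apply: (le_trans HE).
  rewrite ler_pM2l ?mulr_gt0//.
  have -> : eps * (2 + C) = e / 2 by rewrite /eps; field; rewrite gt_eqF// ltr_wpDr.
  rewrite -/W.
  have : W * (1 - r) <= e / 2.
    apply: (@le_trans _ _ ((W + 1) * (e / (2 * (W + 1))))).
      by apply: ler_pM => //; lra.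
    by rewrite le_eqVlt; apply/orP; left; apply/eqP; field; rewrite gt_eqF// ltr_wpDl.
  lra.
have etaC : 0 < (eta%:C)%C :> Cplx R by rewrite ltcR.
have gnear : \forall s \near 1^'-, `|polar 1 t0 - gamma s| < (eta%:C)%C.
  by move/cvgrPdist_lt : gcvg => /(_ _ etaC).
(* Nontangentiality concerns points near the vertex; convergence of the path pulls it back to
   parameters near 1. *)
have gangle' : \forall s \near 1^'-, (gamma @` `[0, 1[) (gamma s) ->
    angle_at (polar 1 t0) alpha beta d (gamma s).
  exact: gcvg gangle.
have s01 : \forall s \near (1 : R)^'-, 0 <= s < 1.
  near=> s; apply/andP; split; last by near: s; exact: nbhs_left_lt.
  by near: s; apply: nbhs_left_ge.
near=> s.
have ss : 0 <= s < 1 by near: s.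
apply: key => //; first by near: s.
have : (gamma @` `[0, 1[) (gamma s) -> angle_at (polar 1 t0) alpha beta d (gamma s).
  by near: s.
by apply; exists s => //; rewrite /= in_itv.
Unshelve. all: by end_near. Qed.
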